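(* Let $R$ be an infinite commutative integral domain with identity, let $n\geqslant 2$ be an integer, and let $\mathrm{Frac}(R)$ denote the fraction field of $R$. A polynomial function $p\colon R^n\to R$ is associative if and only if it is one of the following functions (where $\mathbf{x}=(x_1,\ldots,x_n)$): (i) $p(\mathbf{x})=c$, where $c\in R$; (ii) $p(\mathbf{x})=x_1$; (iii) $p(\mathbf{x})=x_n$; (iv) $p(\mathbf{x})=c+\sum_{i=1}^n x_i$, where $c\in R$; (v) (if $n\geqslant 3$) $p(\mathbf{x})=\sum_{i=1}^n \omega^{i-1}x_i$, where $\omega\in R\setminus\{1\}$ satisfies $\omega^{n-1}=1$; (vi) $p(\mathbf{x})=-b+a\prod_{i=1}^n(x_i+b)$, where $a\in R\setminus\{0\}$ and $b\in\mathrm{Frac}(R)$ satisfy $ab^n-b\in R$ and $ab^k\in R$ for every $k\in\{1,\ldots,n-1\}$.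
   Context: A function $f\colon R^n\to R$ is associative if for every $i\in\{1,\ldots,n-1\}$ and all $x_1,\ldots,x_{2n-1}\in R$, $$f(x_1,\ldots,x_{i-1},f(x_i,\ldots,x_{i+n-1}),x_{i+n},\ldots,x_{2n-1})=f(x_1,\ldots,x_i,f(x_{i+1},\ldots,x_{i+n}),x_{i+n+1},\ldots,x_{2n-1}).$$ A polynomial function $R^n\to R$ is a function induced by a polynomial in $R[x_1,\ldots,x_n]$; since $R$ is an infinite integral domain, polynomial functions are identified with polynomials. *)

(* Defs.v *)
From mathcomp Require Import all_boot all_order all_algebra.
From mathcomp Require Export mpoly.
(* Not imported: the notations of this library clash with those of mpoly. *)
From mathcomp Require classical_sets cardinality.
Set Implicit Arguments.
Unset Strict Implicit.
Unset Printing Implicit Defensive.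
Import GRing.Theory.
Local Open Scope ring_scope.

Definition infinite (T : Type) : Prop :=
  ~ cardinality.finite_set (@classical_sets.setT T).

(* Indices are shifted down by one: a point (x_1, ..., x_n) of R^n is a tuple t
   with x_k = t`_k.-1.  All uses of nth below are within bounds, so its default
   value 0 never occurs. *)

(* The value of f at
     (x_0, ..., x_(i-1), f (x_i, ..., x_(i+n-1)), x_(i+n), ..., x_(2n-2)),
   meaningful for i < n. *)
Definition nested (R : nmodType) (n : nat) (f : n.-tuple R -> R)
    (i : nat) (x : (2 * n - 1).-tuple R) : R :=
  f [tuple if (j < i)%N then x`_j
           else if j == i :> nat then f [tuple x`_(i + k) | k < n]
           else x`_(j + n - 1) | j < n].

Definition associative_fun (R : nmodType) (n : nat) (f : n.-tuple R -> R)
    : Prop :=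
  forall i : nat, (i.+1 < n)%N ->
  forall x : (2 * n - 1).-tuple R, nested f i x = nested f i.+1 x.

Definition polynomial_fun (R : comNzRingType) (n : nat) (f : n.-tuple R -> R)
    : Prop :=
  exists q : {mpoly R[n]}, forall t : n.-tuple R, f t = q.@[tnth t].

Definition in_base (R : idomainType) (z : {fraction R}) : Prop :=
  exists r : R, z = tofrac r.

(* Main.v *)
Require Import Defs.
From mathcomp Require Import all_boot all_order all_algebra.
From mathcomp Require Import zify ring.
From mathcomp Require boolp cardinality.
Set Implicit Arguments.
Unset Strict Implicit.
Unset Printing Implicit Defensive.
Import GRing.Theory.
Local Open Scope ring_scope.

(** Comparing the degrees of the two sides of associativity in each single
    variable shows that a nonconstant [p] is [x_1], or [x_n], or has degree one in
    every variable.  In the last case let [g] be the partial derivative in [x_1];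
    it satisfies [g s * g t = g (...)] where the arguments on the right combine
    [s] and [t].  Hence either [g = 1], and then associativity makes all partial
    derivatives constant, or [g] depends on [x_2] and on [x_n].  In the latter
    case a nonzero slope [a] and intercept [b] of [g] in [x_n] give
    [a p + b = (a x_1 + b) g]; associativity propagates this factorization to
    every variable, so that [p + b / a] is a constant times the product of the
    [x_i + b / a].  The integrality conditions come from finite differences. *)

(** * Polynomial identities over an infinite domain *)

Lemma infinite_uniq_seq (T : eqType) :
  infinite T -> forall m, exists2 s : seq T, uniq s & size s = m.
Proof.
move=> T_inf; elim=> [|m [s s_uniq s_size]]; first by exists [::].
case: (boolp.pselect (exists x, x \notin s)) => [[x xNs]|sT].
  by exists (x :: s); rewrite /= ?xNs ?s_size.
case: T_inf; apply/cardinality.finite_seqP; exists s.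
apply/boolp.funext => x; apply/boolp.propext; split => // _ /=.
by apply/negPn/negP => xNs; apply: sT; exists x.
Qed.

Lemma horner_eq_poly (R : idomainType) (P Q : {poly R}) :
  infinite R -> (forall v, P.[v] = Q.[v]) -> P = Q.
Proof.
move=> R_inf PQ; apply/eqP; rewrite -subr_eq0; apply/negPn/negP => PQ0.
have [s s_uniq s_size] := infinite_uniq_seq R_inf (size (P - Q)).
suff: (size s < size (P - Q)%R)%N by rewrite s_size ltnn.
apply: max_poly_roots => //; apply/allP => x _.
by rewrite /root !hornerE PQ subrr.
Qed.

Definition upd (T : Type) (s : nat -> T) (i : nat) (v : T) : nat -> T :=
  fun j => if j == i then v else s j.

Lemma upd_same (T : Type) (s : nat -> T) i v : upd s i v i = v.
Proof. by rewrite /upd eqxx. Qed.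

Ltac upd_ext := rewrite /upd; repeat (case: ifP => ?); try by [];
  try (exfalso; lia); try (congr (_ _); lia).

(** * Associative functions that are polynomial along each coordinate line *)

Section Classification.
Variables (R : idomainType) (n : nat) (F : (nat -> R) -> R).
Hypothesis R_inf : infinite R.
Hypothesis n_ge2 : (2 <= n)%N.
Hypothesis F_ext : forall s t, (forall i, (i < n)%N -> s i = t i) -> F s = F t.

Definition slice (i : nat) (s : nat -> R) (P : {poly R}) :=
  forall v, P.[v] = F (upd s i v).

Hypothesis F_poly : exists D : nat, forall i s,
  exists2 P : {poly R}, (size P <= D)%N & slice i s P.

(* All the placements of the inner application are compared with the first one;
   since the [2n-1] arguments are free, they are given by two points [s] and
   [t], the entry [s 0] being ignored. *)
Hypothesis F_assoc : forall k s t, (k < n)%N ->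
  F (upd s 0 (F t)) =
  F (fun j => if (j < k)%N then t j
              else if j == k then
                F (fun i => if (i + k < n)%N then t (i + k)%N
                            else s (i + k + 1 - n)%N)
              else s j).

(** Associativity read backwards: the outer and inner points at place [k] are the free data, and
    those at place 0 are recovered from them. *)
Lemma F_assoc_from k s t : (k < n)%N ->
  F (upd s k (F t)) =
  F (upd (fun j => if (j <= k)%N then t (j + n - 1 - k)%N else s j) 0
       (F (fun j => if (j < k)%N then s j else t (j - k)%N))).
Proof.
move=> lt_kn; rewrite (F_assoc _ _ lt_kn); apply: F_ext => j lt_jn.
rewrite /upd; case: ltngtP => // _.
by apply: F_ext => i lt_in; upd_ext.
Qed.

Lemma sliceP i s : exists P, slice i s P.
Proof. by have [D /(_ i s)[P _ sP]] := F_poly; exists P. Qed.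

Lemma slice_uniq i s P Q : slice i s P -> slice i s Q -> P = Q.
Proof. by move=> sP sQ; apply: horner_eq_poly => // v; rewrite sP sQ. Qed.

Lemma slice_comp i s P j t Q : slice i s P -> slice j t Q ->
  forall v, (P \Po Q).[v] = F (upd s i (F (upd t j v))).
Proof. by move=> sP sQ v; rewrite horner_comp sQ sP. Qed.

(** * Dependence on a variable, and the two projections *)

Definition indep (G : (nat -> R) -> R) i := forall s v, G (upd s i v) = G s.

Lemma F_upd_id (s : nat -> R) i : F (upd s i (s i)) = F s.
Proof. by apply: F_ext => j _; rewrite /upd; case: eqP => // ->. Qed.

Lemma slice_const i s P : slice i s P -> (size P <= 1)%N ->
  forall v, F (upd s i v) = F s.
Proof.
by move=> sP /size1_polyC Pc v; rewrite -sP -(F_upd_id s i) -sP Pc !hornerE.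
Qed.

Lemma indep_slice i : indep F i \/ exists s P, slice i s P /\ (1 < size P)%N.
Proof.
case: (boolp.pselect (exists s P, slice i s P /\ (1 < size P)%N)).
  by right.
move=> H; left=> s v; have [P sP] := sliceP i s.
apply: (slice_const sP); rewrite leqNgt; apply/negP => P1.
by apply: H; exists s, P.
Qed.

Lemma indep_const : (forall i, (i < n)%N -> indep F i) ->
  forall s t, F s = F t.
Proof.
move=> Find s t.
have H m : (m <= n)%N -> F (fun j => if (j < m)%N then t j else s j) = F s.
  elim: m => [|m IH] le_mn; first by apply: F_ext.
  rewrite -(IH (ltnW le_mn)) -[RHS](Find m le_mn _ (t m)).
  by apply: F_ext => j _; upd_ext.
by rewrite -(H n (leqnn n)); apply: F_ext => j ->.
Qed.

(* A nonconstant [F] takes infinitely many values, because some slice does. *)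
Lemma eq_on_range (P Q : {poly R}) : (exists s t, F s <> F t) ->
  (forall s, P.[F s] = Q.[F s]) -> P = Q.
Proof.
move=> F_ncst PQ.
have [i [s [S [sS S1]]]] : exists i s P, slice i s P /\ (1 < size P)%N.
  case: (boolp.pselect (exists i s P, slice i s P /\ (1 < size P)%N)) => // H.
  have [s [t]] := F_ncst; case; apply: indep_const => i _.
  by have [//|[s' [S H']]] := indep_slice i; case: H; exists i, s', S.
apply/eqP; rewrite -subr_eq0 -(comp_poly_eq0 _ S1); apply/eqP.
apply: horner_eq_poly => // v.
by rewrite horner_comp sS !hornerE PQ subrr.
Qed.

(** Moved to the last place, the inner value is ignored by [F], so a slice in the first variable
    fixes every value of [F]; there are infinitely many, so the slice is ['X]. *)
Lemma indep_last_proj : (exists s t, F s <> F t) -> indep F n.-1 ->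
  forall s, F s = s 0%N.
Proof.
move=> F_ncst F_last s; have [P sP] := sliceP 0 s.
rewrite -(F_upd_id s 0) -sP (eq_on_range (P := P) (Q := 'X) F_ncst) ?hornerX //= => t.
rewrite hornerX sP (@F_assoc n.-1) ?prednK; try by lia.
apply: etrans (esym (F_last _ 0)) (etrans _ (F_last t 0)); apply: F_ext => j lt_jn.
by upd_ext.
Qed.

Lemma indep_first_proj : (exists s t, F s <> F t) -> indep F 0 ->
  forall s, F s = s n.-1.
Proof.
move=> F_ncst F_first s; have [P sP] := sliceP n.-1 s.
rewrite -(F_upd_id s n.-1) -sP.
rewrite (eq_on_range (P := P) (Q := 'X) F_ncst) ?hornerX //= => t.
rewrite hornerX sP F_assoc_from; last by lia.
rewrite F_first.
apply: etrans (esym (F_first _ 0)) (etrans _ (F_first t 0)); apply: F_ext => j lt_jn.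
by upd_ext.
Qed.

(** * Degrees in a single variable *)

Lemma comp_size P Q T : (forall v, (P \Po Q).[v] = T.[v]) ->
  ((size P).-1 * (size Q).-1)%N = (size (T : {poly R})).-1.
Proof. by move=> H; rewrite -size_comp_poly (horner_eq_poly R_inf H). Qed.

(* The degree of [F] in its first variable is idempotent. *)
Lemma slice_first_size s P : slice 0 s P -> (size P <= 2)%N.
Proof.
move=> sP; rewrite leqNgt; apply/negP => P2.
(* Moved to the last place, the inner application no longer contains the variable, so a slice
   composed with itself is again a slice, of squared degree. Iterating exceeds the uniform bound of
   [F_poly]. *)
have H m : exists s' P', slice 0 s' P' /\ (m.+2 < size P')%N.
  elim: m => [|m [s1 [P1 [sP1 H1]]]]; first by exists s, P.
  have [T sT] := sliceP 0 (upd s1 n.-1 (F (upd s1 0 (s1 n.-1)))).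
  exists (upd s1 n.-1 (F (upd s1 0 (s1 n.-1)))), T; split => //.
  suff /comp_size : forall v, (P1 \Po P1).[v] = T.[v] by nia.
  move=> v; rewrite (slice_comp sP1 sP1) sT (@F_assoc n.-1); last by lia.
  apply: F_ext => j lt_jn; upd_ext.
  by apply: F_ext => i lt_in; upd_ext.
have [D HD] := F_poly.
have [s' [P' [sP' P'D]]] := H D; have [Q QD sQ] := HD 0%N s'.
by have := slice_uniq sP' sQ => P'Q; rewrite P'Q in P'D; lia.
Qed.

Lemma slice_last_size s P : slice n.-1 s P -> (size P <= 2)%N.
Proof.
move=> sP; rewrite leqNgt; apply/negP => P2.
have H m : exists s' P', slice n.-1 s' P' /\ (m.+2 < size P')%N.
  elim: m => [|m [s1 [P1 [sP1 H1]]]]; first by exists s, P.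
  have [T sT] := sliceP n.-1 (upd s1 0 (F (upd s1 n.-1 (s1 0%N)))).
  exists (upd s1 0 (F (upd s1 n.-1 (s1 0%N)))), T; split => //.
  suff /comp_size : forall v, (P1 \Po P1).[v] = T.[v] by nia.
  move=> v; rewrite (slice_comp sP1 sP1) sT F_assoc_from; last by lia.
  apply: F_ext => j lt_jn; upd_ext.
  by apply: F_ext => i lt_in; upd_ext.
have [D HD] := F_poly.
have [s' [P' [sP' P'D]]] := H D; have [Q QD sQ] := HD n.-1 s'.
by have := slice_uniq sP' sQ => P'Q; rewrite P'Q in P'D; lia.
Qed.

(** Of the [2n-1] arguments, the one of index [n.-1] is the last entry of an inner application at
    place 0 and entry [n.-1 - k] of one at place [k]. Comparing the two compositions bounds a
    product of degrees by 1. *)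
Lemma slice_size k s P : ~ indep F 0 -> ~ indep F n.-1 -> (k < n)%N ->
  slice k s P -> (size P <= 2)%N.
Proof.
move=> F0 Fn lt_kn sP.
have [//|[s0 [P0 [sP0 P0_gt1]]]] := indep_slice 0.
have [//|[sn [Pn [sPn Pn_gt1]]]] := indep_slice n.-1.
(* The nonconstant composition of [P0] and [Pn] factors through such a slice. *)
have [s1 [P1 [sP1 P1_gt1]]] : exists s1 P1, slice (n.-1 - k) s1 P1 /\
    (1 < size P1)%N.
  pose t i := if (i + k < n)%N then sn (i + k)%N else s0 (i + k + 1 - n)%N.
  pose s' j := if (j < k)%N then sn j else s0 j.
  have [P1 sP1] := sliceP (n.-1 - k) t.
  have [P2 sP2] := sliceP k s'.
  exists t, P1; split => //.
  suff /comp_size : forall v, (P0 \Po Pn).[v] = (P2 \Po P1).[v].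
    by rewrite size_comp_poly; nia.
  move=> v; rewrite (slice_comp sP0 sPn) (slice_comp sP2 sP1) (F_assoc _ _ lt_kn).
  apply: F_ext => j lt_jn; rewrite /s'; upd_ext.
  by apply: F_ext => i lt_in; rewrite /t; upd_ext.
pose s' j := if (j <= k)%N then s1 (j + n - 1 - k)%N else s j.
pose t j := if (j < k)%N then s j else s1 (j - k)%N.
have [Q0 sQ0] := sliceP 0 s'; have [Qn sQn] := sliceP n.-1 t.
have Q0_size := slice_first_size sQ0; have Qn_size := slice_last_size sQn.
suff /comp_size : forall v, (P \Po P1).[v] = (Q0 \Po Qn).[v].
  by rewrite size_comp_poly; nia.
move=> v; rewrite (slice_comp sP sP1) (slice_comp sQ0 sQn) F_assoc_from //.
apply: F_ext => j lt_jn; rewrite /s'; upd_ext.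
by apply: F_ext => i lt_in; rewrite /t; upd_ext.
Qed.

Lemma slice_affine k s : ~ indep F 0 -> ~ indep F n.-1 -> (k < n)%N ->
  forall v, F (upd s k v) =
    F (upd s k 0) + v * (F (upd s k 1) - F (upd s k 0)).
Proof.
move=> F0 Fn lt_kn v; have [P sP] := sliceP k s.
have P2 := slice_size F0 Fn lt_kn sP.
by rewrite -!sP !(horner_coef_wide _ P2) !big_ord_recl !big_ord0 /=; ring.
Qed.

(** The partial derivative in variable [k] once [F] is affine in it. *)
Definition dF k s := F (upd s k 1) - F (upd s k 0).

(* [join k t s] and [shift k t s] are the outer and inner arguments when the
   inner application sits at position [k]. *)
Definition join k (t s : nat -> R) j := if (j < k)%N then t j else s j.

Definition shift k (t s : nat -> R) i :=
  if (i + k < n)%N then t (i + k)%N else s (i + k + 1 - n)%N.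

Lemma F_assoc_join k s t : (k < n)%N ->
  F (upd s 0 (F t)) = F (upd (join k t s) k (F (shift k t s))).
Proof.
move=> lt_kn; rewrite (F_assoc _ _ lt_kn); apply: F_ext => j lt_jn.
by rewrite /upd /join; case: ltngtP.
Qed.

Lemma dF_ext k s t : (forall j, (j < n)%N -> j != k -> s j = t j) ->
  dF k s = dF k t.
Proof.
move=> st; rewrite /dF; congr (_ - _); apply: F_ext => j lt_jn;
  by rewrite /upd; case: eqP => // /eqP; apply: st.
Qed.

(** * Multiaffine associative functions *)

Section Multiaffine.
Hypothesis F_affine : forall k s v, (k < n)%N ->
  F (upd s k v) = F (upd s k 0) + v * dF k s.

Lemma F_affine_at k s : (k < n)%N -> F s = F (upd s k 0) + s k * dF k s.
Proof. by move=> lt_kn; rewrite -F_affine // F_upd_id. Qed.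

Lemma sum_form : (forall s, dF 0 s = 1) -> ~ indep F n.-1 ->
  exists c w, [/\ w ^+ (n - 1) = 1, c * w = c &
    forall s, F s = c + \sum_(i < n) w ^+ i * s i].
Proof.
move=> dF0 F_last.
have F0E s v : F (upd s 0 v) = F (upd s 0 0) + v.
  by rewrite F_affine ?dF0 ?mulr1 //; lia.
(* Entry [k] of [t] becomes the first entry of the inner application at place [k], where the slope
   is one. As [s] is arbitrary, [dF k t] depends only on the entries below [k]. *)
have dF_join k s t : (0 < k < n)%N -> dF k t = dF k (join k t s).
  move=> /andP[k_gt0 lt_kn].
  have E b : F (upd s 0 0) + F (upd t k b) = F (upd (join k t s) k 0) +
      (F (upd (shift k t s) 0 0) + b) * dF k (join k t s).
    rewrite -F0E (F_assoc_join _ _ lt_kn) -F0E -F_affine //.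
    congr F; apply/boolp.funext => j; rewrite /upd /join.
    case: ltngtP => // _; apply: F_ext => i lt_in.
    by rewrite /shift; upd_ext.
  transitivity ((F (upd s 0 0) + F (upd t k 1)) - (F (upd s 0 0) + F (upd t k 0))).
    by rewrite /dF; ring.
  by rewrite !E; ring.
pose o : nat -> R := fun=> 0; pose c := F o; pose w k := dF k o.
have sumE s : F s = c + \sum_(k < n) w k * s k.
  have H m : (m <= n)%N ->
      F s = F (join m o s) + \sum_(k < m) w k * s k.
    elim: m => [|m IH] le_mn.
      by rewrite big_ord0 addr0; apply: F_ext.
    rewrite (IH (ltnW le_mn)) big_ord_recr /= addrCA addrC; congr (_ + _).
    rewrite (F_affine_at (join m o s) le_mn) {1 2}/join ltnn.
    congr (_ + _); last first.
      rewrite mulrC; congr (_ * _); case: m {IH} le_mn => [|m] le_mn.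
        by rewrite /w !dF0.
      rewrite /w (dF_join m.+1 o) //; apply: dF_ext => j _ _.
      by rewrite /join; do 2?case: ifP.
    by apply: F_ext => j lt_jn; rewrite /join; upd_ext.
  by rewrite (H n) //; congr (_ + _); apply: F_ext => j lt_jn; rewrite /join lt_jn.
have updE k b : (k < n)%N -> F (upd o k b) = c + w k * b.
  move=> lt_kn; rewrite F_affine // mulrC; congr (_ + _).
  by apply: F_ext => j _; rewrite /upd; case: ifP.
have w0 : w 0%N = 1 by apply: dF0.
have lt0n : (0 < n)%N by lia.
have cE k : (k < n)%N -> c * w k = c.
  move=> lt_kn; have := F_assoc_join o o lt_kn.
  rewrite updE // w0 mul1r.
  have -> : upd (join k o o) k (F (shift k o o)) = upd o k c.
    apply/boolp.funext => j; rewrite /upd /join; case: eqP => _; last by case: ifP.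
    by apply: F_ext => i _; rewrite /shift; case: ifP.
  by rewrite updE // => /addrI; rewrite mulrC => <-.
have lt1n : (1 < n)%N by [].
(* The argument set to 1 is entry [k.+1] of the inner application at place 0, and entry [k] of the
   one at place 1. *)
have wS k : (k.+1 < n)%N -> w k.+1 = w 1%N * w k.
  move=> lt_kn; have := F_assoc_join o (upd o k.+1 1) lt1n.
  have -> : upd (join 1 (upd o k.+1 1) o) 1 (F (shift 1 (upd o k.+1 1) o)) =
            upd o 1 (F (upd o k 1)).
    apply/boolp.funext => j; rewrite /upd /join; case: eqP => _.
      by apply: F_ext => i lt_in; rewrite /shift; upd_ext.
    by upd_ext.
  rewrite !updE ?w0 ?mul1r ?mulr1; try by lia.
  by rewrite mulrDr [w 1%N * c]mulrC cE // => /addrI /addrI.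
have wE k : (k < n)%N -> w k = w 1%N ^+ k.
  elim: k => [|k IH] lt_kn; first by rewrite w0.
  by rewrite wS // IH ?exprS //; lia.
exists c, (w 1%N); split; last 1 first.
- by move=> s; rewrite sumE; congr (_ + _); apply: eq_bigr => k _; rewrite wE.
- rewrite subn1 -wE; last by lia.
  have lt_n1 : (n.-1 < n)%N by lia.
  have wn0 : w n.-1 != 0.
    apply/eqP => wn0; apply: F_last => s v; rewrite !sumE; congr (_ + _).
    apply: eq_bigr => k _; rewrite /upd; case: eqP => // ->.
    by rewrite wn0 !mul0r.
  (* The last of all arguments gets weight [w n.-1] from nesting at place 0 and its square from
     nesting at the last place. *)
  have := F_assoc_join (upd o n.-1 1) o lt_n1.
  have -> : upd (join n.-1 o (upd o n.-1 1)) n.-1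
      (F (shift n.-1 o (upd o n.-1 1))) = upd o n.-1 (F (upd o n.-1 1)).
    apply/boolp.funext => j; rewrite /upd /join; case: eqP => _.
      by apply: F_ext => i lt_in; rewrite /shift; upd_ext.
    by upd_ext.
  rewrite F0E !updE // mulr1 -/c.
  have -> : F (upd (upd o n.-1 1) 0 0) = F (upd o n.-1 1).
    by apply: F_ext => j _; upd_ext.
  rewrite updE // mulr1 mulrDr [_ * c]mulrC cE //.
  rewrite -addrA => /addrI; rewrite addrC => /addrI.
  by rewrite -[LHS]mulr1 => /(mulfI wn0).
by apply: cE.
Qed.
(** Chain rule in the first of all arguments: it crosses two applications when the inner one is at
    place 0, but only the outer one when [k > 0]. *)
Lemma dF_mul k s t : (0 < k < n)%N ->
  dF 0 s * dF 0 t = dF 0 (upd (join k t s) k (F (shift k t s))).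
Proof.
move=> /andP[k_gt0 lt_kn]; have lt0n : (0 < n)%N by lia.
have E b : F (upd s 0 0) + F (upd t 0 b) * dF 0 s =
    F (upd (upd (join k t s) k (F (shift k t s))) 0 b).
  rewrite -F_affine // (F_assoc_join _ _ lt_kn).
  have -> : F (shift k (upd t 0 b) s) = F (shift k t s).
    by apply: F_ext => j lt_jn; rewrite /shift; upd_ext.
  by apply: F_ext => j lt_jn; rewrite /join; upd_ext.
by rewrite [RHS]/dF -!E /dF; ring.
Qed.

(** If [dF 0] ignores the place where [dF_mul] inserts the inner value, the product collapses to one
    of its factors, which is then cancelled. *)
Lemma dF_first_eq1_or_dep : ~ indep F 0 ->
  (forall s, dF 0 s = 1) \/ (~ indep (dF 0) 1 /\ ~ indep (dF 0) n.-1).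
Proof.
move=> F_first; have lt0n : (0 < n)%N by lia.
have [s0 s0_neq0] : exists s, dF 0 s != 0.
  case: (boolp.pselect (exists s, dF 0 s != 0)) => // H; case: F_first => s v.
  have dF0 : dF 0 s = 0 by apply/eqP/negPn/negP => dFs; apply: H; exists s.
  by rewrite F_affine // [in RHS](F_affine_at _ lt0n) dF0 !mulr0.
case: (boolp.pselect (forall s, dF 0 s = 1)) => [|F_neq1]; first by left.
right; split=> F_indep; apply: F_neq1 => t.
  apply: (mulfI s0_neq0); rewrite (@dF_mul 1) ?n_ge2 // F_indep mulr1.
  by apply: dF_ext => -[|j].
have [t0|t_neq0] := eqVneq (dF 0 t) 0.
  have := @dF_mul n.-1 t s0; rewrite t0 mul0r F_indep => H.
  case/eqP: s0_neq0; apply: etrans (esym _) (esym (H _)); last by lia.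
  rewrite -[LHS](F_indep _ 0) -[RHS](F_indep _ 0); apply: dF_ext => j lt_jn _.
  by rewrite /join; upd_ext.
have : dF 0 t * dF 0 t = dF 0 t.
  rewrite (@dF_mul n.-1); last by lia.
  rewrite F_indep -[LHS](F_indep _ 0) -[RHS](F_indep _ 0).
  by apply: dF_ext => j lt_jn _; rewrite /join; upd_ext.
by rewrite -[RHS]mulr1 => /(mulfI t_neq0).
Qed.

Lemma factor_form : ~ indep (dF 0) 1 -> ~ indep (dF 0) n.-1 ->
  exists a b, a != 0 /\ forall k s, (k < n)%N ->
    a * F s + b = (a * s k + b) * dF k s.
Proof.
move=> dep1 depn; have lt0n : (0 < n)%N by lia.
have dF_affine s v : dF 0 (upd s n.-1 v) = dF 0 (upd s n.-1 0) +
    v * (dF 0 (upd s n.-1 1) - dF 0 (upd s n.-1 0)).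
  have C x y : F (upd (upd s n.-1 x) 0 y) = F (upd (upd s 0 y) n.-1 x).
    by apply: F_ext => j lt_jn; upd_ext.
  rewrite {1 2 4}/dF !C F_affine; last by lia.
  rewrite [F (upd _ _ v)]F_affine; last by lia.
  by rewrite /dF !C; ring.
have [s2 s2_neq0] : exists s, dF 0 (upd s n.-1 1) - dF 0 (upd s n.-1 0) != 0.
  case: (boolp.pselect (exists s,
    dF 0 (upd s n.-1 1) - dF 0 (upd s n.-1 0) != 0)) => // H; case: depn => s v.
  have dF0 : dF 0 (upd s n.-1 1) - dF 0 (upd s n.-1 0) = 0.
    by apply/eqP/negPn/negP => dFs; apply: H; exists s.
  rewrite dF_affine dF0 mulr0; have := dF_affine s (s n.-1).
  rewrite dF0 mulr0 => <-; apply: dF_ext => j _ _.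
  by rewrite /upd; case: eqP => // ->.
set a := dF 0 _ - _ in s2_neq0; pose b := dF 0 (upd s2 n.-1 0).
have first_form s : a * F s + b = (a * s 0%N + b) * dF 0 s.
  have lt_n1 : (0 < n.-1 < n)%N by lia.
  (* With this last entry, the inner application at place [n.-1] receives exactly [s]. *)
  have := dF_mul s (upd s2 n.-1 (s 0%N)) lt_n1.
  rewrite dF_affine -/a -/b.
  set u := upd _ _ _; have -> : dF 0 u = dF 0 (upd s2 n.-1 (F s)).
    rewrite /u; apply: dF_ext => j lt_jn _; rewrite /join /upd.
    case: eqP => [_|]; last by case: ifP => //; lia.
    by apply: F_ext => i lt_in; rewrite /shift; upd_ext.
  by rewrite dF_affine -/a -/b => H; rewrite addrC [a * _]mulrC -H; ring.
exists a, b; split=> // -[|k] s lt_kn; first exact: first_form.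
(* [Q x] is [a * F x + b - (a * x k.+1 + b) * dF k.+1 x]. *)
pose Q x := a * F (upd x k.+1 0) + b - b * dF k.+1 x.
suff Q0 t : Q t = 0.
  rewrite (F_affine_at s lt_kn); apply/eqP; rewrite -subr_eq0; apply/eqP.
  by rewrite -[RHS](Q0 s) /Q; ring.
(* With entry [k.+1] of [t] set to [c], [first_form] expands both nestings as affine functions of
   [c]. Equal slopes cancel the multiples of [a * c + b] and leave the remainders [Q]. *)
have QE x : Q t * dF 0 x = Q (join k.+1 t x).
  have E c : (dF k.+1 t * (a * c + b) + Q t) * dF 0 x =
      dF k.+1 (join k.+1 t x) * (a * c + b) * dF 0 (shift k.+1 t x) +
      Q (join k.+1 t x).
    have -> : dF k.+1 t * (a * c + b) + Q t = a * F (upd t k.+1 c) + b.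
      by rewrite F_affine // /Q; ring.
    have := first_form (upd x 0 (F (upd t k.+1 c))).
    rewrite upd_same.
    have -> : dF 0 (upd x 0 (F (upd t k.+1 c))) = dF 0 x.
      by apply: dF_ext => j _; rewrite /upd => /negPf ->.
    move=> <-; rewrite (F_assoc_join _ _ lt_kn).
    have -> : F (shift k.+1 (upd t k.+1 c) x) = F (upd (shift k.+1 t x) 0 c).
      by apply: F_ext => j lt_jn; rewrite /shift; upd_ext.
    rewrite F_affine //.
    have := first_form (upd (shift k.+1 t x) 0 c).
    rewrite upd_same.
    have -> : dF 0 (upd (shift k.+1 t x) 0 c) = dF 0 (shift k.+1 t x).
      by apply: dF_ext => j _; rewrite /upd => /negPf ->.
    have J : forall j, (j < n)%N -> j != k.+1 ->
        join k.+1 (upd t k.+1 c) x j = join k.+1 t x j.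
      by move=> j _ /negPf j_neq; rewrite /join /upd j_neq.
    rewrite (dF_ext J).
    have -> : F (upd (join k.+1 (upd t k.+1 c) x) k.+1 0) =
              F (upd (join k.+1 t x) k.+1 0).
      by apply: F_ext => j lt_jn; rewrite /join; upd_ext.
    by rewrite /Q -mulrA => <-; ring.
  have E1 : a * (dF k.+1 t * dF 0 x) =
      a * (dF k.+1 (join k.+1 t x) * dF 0 (shift k.+1 t x)).
    transitivity ((dF k.+1 t * (a * 1 + b) + Q t) * dF 0 x -
                  (dF k.+1 t * (a * 0 + b) + Q t) * dF 0 x); first by ring.
    by rewrite !E; ring.
  have := E 0; rewrite mulr0 add0r mulrDl [_ * b]mulrC [_ * b]mulrC -!mulrA.
  by rewrite (mulfI s2_neq0 E1) => /addrI.
(* The right side of [QE] ignores entry 1 of [x]: [join] overwrites it if [k > 0], and it is the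
   variable absent from [Q] if [k = 0]. So a nonzero [Q t] would make [dF 0] independent of it. *)
case: (boolp.pselect (Q t = 0)) => // /eqP Qt_neq0; case: dep1 => x v.
apply: (mulfI Qt_neq0); rewrite !QE /Q.
have J : forall j, (j < n)%N -> j != k.+1 ->
    join k.+1 t (upd x 1 v) j = join k.+1 t x j.
  by move=> j lt_jn j_neq; rewrite /join; upd_ext.
rewrite (dF_ext J); congr (_ * _ + _ - _); apply: F_ext => j lt_jn.
by rewrite /upd; case: eqP => // /eqP; apply: J.
Qed.

Lemma cancel_fractions (K : fieldType) (x y u v w : K) : x != 0 -> y != 0 ->
  u * w * v = x * (y * (v * u / y / x * w)).
Proof. by move=> x0 y0; field; rewrite x0 y0. Qed.

(** The factorizations let each entry in [a * F + b] be exchanged for a fixed [z] with [a * z + b]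
    nonzero; after [n] exchanges only a constant times the product of the factors remains. *)
Lemma product_form (a b : R) : (exists s t, F s <> F t) -> a != 0 ->
  (forall k s, (k < n)%N -> a * F s + b = (a * s k + b) * dF k s) ->
  exists (c : R) (d : {fraction R}),
    [/\ c != 0, in_base (tofrac c * d ^+ n - d),
         forall k : nat, (1 <= k <= n - 1)%N -> in_base (tofrac c * d ^+ k) &
         forall s, tofrac (F s) =
           - d + tofrac c * \prod_(i < n) (tofrac (s i) + d)].
Proof.
move=> F_ncst a_neq0 FE.
have [z e_neq0] : exists z, a * z + b != 0.
  have [->|b_neq0] := eqVneq b 0; first by exists 1; rewrite mulr1 addr0.
  by exists 0; rewrite mulr0 add0r.
set e := a * z + b in e_neq0; pose H t := a * F t + b.
have exchange k t : (k < n)%N -> e * H t = (a * t k + b) * H (upd t k z).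
  move=> lt_kn; rewrite /H !(FE k) // upd_same -/e mulrCA.
  by congr (_ * (_ * _)); apply: dF_ext => j _; rewrite /upd => /negPf ->.
have HE m t : (m <= n)%N ->
    e ^+ m * H t = (\prod_(k < m) (a * t k + b)) * H (join m (fun=> z) t).
  elim: m => [|m IH] le_mn.
    by rewrite big_ord0 expr0 !mul1r /H; congr (_ * _ + _); apply: F_ext.
  rewrite exprS -mulrA IH ?(ltnW le_mn) // mulrCA (exchange m) // big_ord_recr /=.
  rewrite -mulrA {1}/join ltnn; congr (_ * (_ * (_ * _ + _))).
  by apply: F_ext => j lt_jn; rewrite /join; upd_ext.
pose d := tofrac b / tofrac a.
have fa_neq0 : tofrac a != 0 by rewrite tofrac_eq0.
have fe_neq0 : tofrac e != 0 by rewrite tofrac_eq0.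
(* Each factor [a * s i + b] yields an [a], each exchange divides by [e], and the last division
   turns [H] into [F + d]. *)
pose c := tofrac (H (fun=> z)) * tofrac a ^+ n / tofrac e ^+ n / tofrac a.
have FcE s : tofrac (F s) + d = c * \prod_(i < n) (tofrac (s i) + d).
  have /(congr1 (@tofrac R)) := HE n s (leqnn n).
  have -> : H (join n (fun=> z) s) = H (fun=> z).
    by rewrite /H; congr (_ * _ + _); apply: F_ext => j lt_jn; rewrite /join lt_jn.
  rewrite !tofracM tofracXn rmorph_prod /= => E.
  have Ed x : tofrac (a * x + b) = tofrac a * (tofrac x + d).
    by rewrite tofracD tofracM /d mulrDr mulrCA divff // mulr1.
  move: E; rewrite (eq_bigr (fun i : 'I_n => tofrac a * (tofrac (s i) + d))).
    rewrite big_split /= prodr_const card_ord /H Ed => E.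
    apply: (mulfI (expf_neq0 n fe_neq0)); apply: (mulfI fa_neq0).
    rewrite mulrCA E; apply: cancel_fractions => //.
    exact: expf_neq0.
  by move=> i _; apply: Ed.
(* Finite differences in the last variable show that the [K m] are in the base. *)
pose K m (s : nat -> R) := c * \prod_(i < m) (tofrac (s i) + d).
have baseB x y : in_base x -> in_base y -> in_base (x - y).
  by move=> [r ->] [r' ->]; exists (r - r'); rewrite tofracB.
have K_base m : (m <= n)%N ->
    (forall s t, in_base (K (n - m)%N s - K (n - m)%N t)) /\
    ((0 < m)%N -> forall s, in_base (K (n - m)%N s)).
  elim: m => [|m IH] le_mn.
    split=> // s t; rewrite subn0 /K -!FcE opprD addrACA subrr addr0.
    by exists (F s - F t); rewrite tofracB.
  have K_base s : in_base (K (n - m.+1)%N s).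
    have := (IH (ltnW le_mn)).1 (upd s (n - m.+1) 1) (upd s (n - m.+1) 0).
    have -> : (n - m = (n - m.+1).+1)%N by lia.
    rewrite /K !big_ord_recr /= /upd !eqxx.
    have PE (v : R) : \prod_(i < n - m.+1)
        (tofrac (if i == (n - m.+1)%N :> nat then v else s i) + d) =
        \prod_(i < n - m.+1) (tofrac (s i) + d).
      by apply: eq_bigr => i _; case: eqP => // Ei; have := ltn_ord i; rewrite Ei ltnn.
    rewrite !PE tofrac1 tofrac0; set P := \prod_(i < _) _.
    by have -> : c * (P * (1 + d)) - c * (P * (0 + d)) = c * P by ring.
  by split=> // s t; apply: baseB.
have [c' cE] : in_base c.
  have := (K_base n (leqnn n)).2; rewrite subnn /K => KB.
  by have := KB (ltnW n_ge2) (fun=> 0); rewrite big_ord0 mulr1.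
have FE' s : tofrac (F s) = - d + tofrac c' * \prod_(i < n) (tofrac (s i) + d).
  by rewrite -cE -FcE addrC addrK.
have F0 : tofrac (F (fun=> 0)) = - d + tofrac c' * d ^+ n.
  by rewrite FE' prodr_const card_ord tofrac0 add0r.
exists c', d; split => //.
- apply/eqP => c'0; have [s [t]] := F_ncst; case; apply/eqP.
  by rewrite -tofrac_eq !FE' c'0 tofrac0 !mul0r.
- by exists (F (fun=> 0)); rewrite F0 addrC.
- move=> k /andP[k_gt0 le_kn].
  have := (K_base (n - k)%N (leq_subr _ _)).2.
  have -> : (n - (n - k) = k)%N by lia.
  rewrite /K -cE => KB; have := KB _ (fun=> 0).
  by rewrite prodr_const card_ord tofrac0 add0r; apply; lia.
Qed.
End Multiaffine.
End Classification.

(** * From functions of tuples to functions of sequences *)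

Lemma nth_mktuple_lt (T : Type) (x0 : T) (s : nat -> T) m i : (i < m)%N ->
  nth x0 [tuple s j | j < m] i = s i.
Proof. by move=> lt_im; rewrite -[i]/(val (Ordinal lt_im)) nth_mktuple. Qed.

Definition seq_fun (R : nmodType) n (p : n.-tuple R -> R) (s : nat -> R) : R :=
  p [tuple s i | i < n].

Section SeqFun.
Variables (R : idomainType) (n : nat) (p : n.-tuple R -> R).

Lemma seq_fun_ext s t : (forall i, (i < n)%N -> s i = t i) ->
  seq_fun p s = seq_fun p t.
Proof.
by move=> st; congr p; apply: eq_from_tnth => i; rewrite !tnth_mktuple st.
Qed.

Lemma seq_fun_nth (x : n.-tuple R) : seq_fun p (nth 0 x) = p x.
Proof.
by congr p; apply: eq_from_tnth => i; rewrite tnth_mktuple [RHS](tnth_nth 0).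
Qed.

Lemma nestedE i (x : (2 * n - 1).-tuple R) : nested p i x =
  seq_fun p (fun j => if (j < i)%N then x`_j
    else if j == i then seq_fun p (fun k => x`_(i + k)) else x`_(j + n - 1)).
Proof. by []. Qed.

Lemma associative_seq_fun k s t : associative_fun p -> (k < n)%N ->
  seq_fun p (upd s 0 (seq_fun p t)) =
  seq_fun p (fun j => if (j < k)%N then t j
              else if j == k then
                seq_fun p (fun i => if (i + k < n)%N then t (i + k)%N
                            else s (i + k + 1 - n)%N)
              else s j).
Proof.
move=> p_assoc lt_kn.
(* The entries of [t], followed by those of [s] from index 1 on. *)
pose x : (2 * n - 1).-tuple R :=
  [tuple if (i < n)%N then t i else s (i + 1 - n)%N | i < 2 * n - 1].
have xE i : (i < 2 * n - 1)%N ->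
    x`_i = if (i < n)%N then t i else s (i + 1 - n)%N.
  exact: (@nth_mktuple_lt _ _ (fun i => if (i < n)%N then t i else s (i + 1 - n)%N)).
have : nested p 0 x = nested p k x.
  elim: k lt_kn => // k IH lt_kn; rewrite IH; last by lia.
  exact: p_assoc.
have E k' : (k' < n)%N -> nested p k' x =
  seq_fun p (fun j => if (j < k')%N then t j
              else if j == k' then
                seq_fun p (fun i => if (i + k' < n)%N then t (i + k')%N
                            else s (i + k' + 1 - n)%N)
              else s j).
  move=> lt_k'n; rewrite nestedE; apply: seq_fun_ext => j lt_jn.
  case: ltngtP => [lt_jk|lt_kj|_].
  - by rewrite xE; [case: ifP => //|]; lia.
  - rewrite xE; last by lia.
    by case: ifP => [|_]; [lia|congr s; lia].
  - apply: seq_fun_ext => i lt_in; rewrite xE; last by lia.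
    by rewrite addnC.
rewrite !E //; last by lia.
move=> <-; apply: seq_fun_ext => j lt_jn; rewrite /upd; case: eqP => // _.
by apply: seq_fun_ext => i lt_in; rewrite addn0 lt_in.
Qed.

Lemma polynomial_seq_fun : polynomial_fun p ->
  exists D : nat, forall k s,
    exists2 P : {poly R}, (size P <= D)%N & slice (seq_fun p) k s P.
Proof.
case=> q pE; exists (\max_(m <- msupp q) (mdeg m).+1) => k s.
pose u (i : 'I_n) : {poly R} := if i == k :> nat then 'X else (s i)%:P.
exists (\sum_(m <- msupp q) (q@_m)%:P * \prod_i u i ^+ m i); last first.
  move=> v; rewrite /seq_fun pE mevalE horner_sum; apply: eq_bigr => m _.
  rewrite hornerM hornerC horner_prod; congr (_ * _); apply: eq_bigr => i _.
  rewrite horner_exp tnth_mktuple /u /upd.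
  by case: eqP; rewrite ?hornerX ?hornerC.
apply: leq_trans (size_sum _ _ _) _.
elim/big_ind2: _ => // [a b c d ab cd|m _]; first by rewrite geq_max; lia.
have : (size (\prod_i u i ^+ m i)%R <= (mdeg m).+1)%N.
  rewrite mdegE; elim/big_ind2: _ => [|P a Q b Pa Qb|i _].
  - by rewrite size_poly1.
  - by apply: leq_trans (size_polyMleq _ _) _; lia.
  - apply: leq_trans (size_poly_exp_leq _ _) _; rewrite ltnS.
    have : ((size (u i)).-1 <= 1)%N.
      rewrite /u; case: ifP => _; first by rewrite size_polyX.
      by rewrite size_polyC; case: (s i != 0).
    by case: (size _).-1 => [|[|]] //; rewrite ?mul1n.
apply: leq_trans; apply: leq_trans (size_polyMleq _ _) _.
by rewrite size_polyC; case: (q@_m != 0) => /=; lia.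
Qed.
End SeqFun.

(** * Associativity of the listed functions *)

Lemma big_nested (T : Type) (idx : T) (op : Monoid.com_law idx) n i
    (u : nat -> T) e : (i < n)%N ->
  \big[op/idx]_(j < n) (if (j < i)%N then u j
      else if j == i :> nat then op e (\big[op/idx]_(k < n) u (i + k)%N)
      else u (j + n - 1)%N) =
  op e (\big[op/idx]_(j < 2 * n - 1) u j).
Proof.
move=> lt_in; rewrite -!(big_mkord xpredT).
rewrite -(big_mkord xpredT (fun j => if (j < i)%N then u j
  else if j == i then _ else u (j + n - 1)%N)).
rewrite (@big_cat_nat _ _ _ i) ?(ltnW lt_in) //= (@big_ltn _ _ _ i) //.
rewrite ltnn eqxx [in RHS](@big_cat_nat _ _ _ i) //=; last by lia.
rewrite [X in op e (op _ X)](@big_cat_nat _ _ _ (i + n)) //=; try by lia.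
rewrite -Monoid.mulmA Monoid.mulmCA; congr (op _ (op _ (op _ _))).
- by apply: eq_big_nat => j /andP[_ ->].
- rewrite -[RHS]/(\big[op/idx]_(0 + i <= j < i + n) u j) big_addn addKn big_mkord.
  by apply: eq_bigr => k _; rewrite addnC.
have -> : (i + n = i.+1 + (n - 1))%N by lia.
rewrite big_addn.
have -> : (2 * n - 1 - (n - 1) = n)%N by lia.
apply: eq_big_nat => j /andP[lt_ij _]; case: ltngtP => //; try by lia.
by move=> _; congr u; lia.
Qed.

(** A shift by [n - 1] places preserves weights because [w ^+ (n - 1) = 1], and the inner constant
    keeps its value at every place because [c * w = c]. *)
Lemma sum_form_assoc (R : idomainType) n (p : n.-tuple R -> R) (c w : R) :
  w ^+ (n - 1) = 1 -> c * w = c ->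
  (forall x : n.-tuple R, p x = c + \sum_(i < n) w ^+ i * x`_i) ->
  associative_fun p.
Proof.
move=> w1 cw pE.
have FE s : seq_fun p s = c + \sum_(i < n) w ^+ i * s i.
  rewrite /seq_fun pE; congr (_ + _); apply: eq_bigr => i _.
  by rewrite nth_mktuple_lt.
have cwX i : w ^+ i * c = c.
  by elim: i => [|i IH]; rewrite ?mul1r // exprSr -mulrA [w * c]mulrC cw.
have H i x : (i < n)%N ->
    nested p i x = c + (c + \sum_(j < 2 * n - 1) w ^+ j * x`_j).
  move=> lt_in; rewrite nestedE FE; congr (_ + _).
  rewrite -(@big_nested _ _ _ n i (fun j => w ^+ j * x`_j)) //.
  apply: eq_bigr => j _; case: ltngtP => // [lt_ij|->].
    congr (_ * _); have -> : (j + n - 1 = j + (n - 1))%N by lia.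
    by rewrite exprD w1 mulr1.
  rewrite FE mulrDr cwX mulr_sumr; congr (_ + _); apply: eq_bigr => k _.
  by rewrite mulrA exprD.
by move=> i lt_in x; rewrite !H //; lia.
Qed.

(** Translation by [b] conjugates [p], over the fraction field, to [a] times the product of its
    arguments. *)
Lemma product_form_assoc (R : idomainType) n (p : n.-tuple R -> R) (a : R)
    (b : {fraction R}) :
  (forall x : n.-tuple R,
     tofrac (p x) = - b + tofrac a * \prod_(i < n) (tofrac x`_i + b)) ->
  associative_fun p.
Proof.
move=> pE.
have FE s : tofrac (seq_fun p s) + b =
    tofrac a * \prod_(i < n) (tofrac (s i) + b).
  rewrite /seq_fun pE addrC addNKr; congr (_ * _); apply: eq_bigr => i _.
  by rewrite nth_mktuple_lt.
have H i x : (i < n)%N -> tofrac (nested p i x) + b =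
    tofrac a * (tofrac a * \prod_(j < 2 * n - 1) (tofrac x`_j + b)).
  move=> lt_in; rewrite nestedE FE; congr (_ * _).
  rewrite -(@big_nested _ _ _ n i (fun j => tofrac x`_j + b)) //.
  by apply: eq_bigr => j _; case: ltngtP => // _; rewrite FE.
move=> i lt_in x; apply/eqP; rewrite -tofrac_eq -(inj_eq (addIr b)) !H //; lia.
Qed.

(** * Assembly of both directions of the classification *)

Theorem mainTheorem1 (R : idomainType) (R_inf : infinite R)
    (n : nat) (n_ge2 : (2 <= n)%N)
    (p : n.-tuple R -> R) (p_poly : polynomial_fun p) :
  associative_fun p <->
  (exists c : R, forall x : n.-tuple R, p x = c) \/
  (forall x : n.-tuple R, p x = x`_0) \/
  (forall x : n.-tuple R, p x = x`_n.-1) \/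
  (exists c : R, forall x : n.-tuple R, p x = c + \sum_(i < n) x`_i) \/
  ((3 <= n)%N /\
   exists w : R, [/\ w != 1, w ^+ (n - 1) = 1 &
     forall x : n.-tuple R, p x = \sum_(i < n) w ^+ i * x`_i]) \/
  (exists (a : R) (b : {fraction R}),
     [/\ a != 0,
         in_base (tofrac a * b ^+ n - b),
         forall k : nat, (1 <= k <= n - 1)%N -> in_base (tofrac a * b ^+ k) &
         forall x : n.-tuple R,
           tofrac (p x) = - b + tofrac a * \prod_(i < n) (tofrac x`_i + b)]).
Proof.
split; last first.
  case=> [[c pE]|[pE|[pE|[[c pE]|[[_ [w [_ w1 pE]]]|[a [b [_ _ _ pE]]]]]]]].
  - by move=> i _ x; rewrite /nested !pE.
  - have H i x : nested p i x = x`_0.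
      rewrite /nested pE (@nth_mktuple_lt _ _ (fun j => if (j < i)%N then x`_j
        else if j == i then p [tuple x`_(i + k) | k < n]
        else x`_(j + n - 1))); last by lia.
      case: ltngtP => // <-.
      by rewrite pE (@nth_mktuple_lt _ _ (fun k => x`_(0 + k))) //; lia.
    by move=> i _ x; rewrite !H.
  - have H i x : (i < n)%N -> nested p i x = x`_(n.-1 + n.-1).
      move=> lt_in.
      rewrite /nested pE (@nth_mktuple_lt _ _ (fun j => if (j < i)%N then x`_j
        else if j == i then p [tuple x`_(i + k) | k < n]
        else x`_(j + n - 1))); last by lia.
      case: ltngtP => [||<-]; [lia|by move=> _; congr (_`_ _); lia|].
      by rewrite pE (@nth_mktuple_lt _ _ (fun k => x`_(n.-1 + k))) //; lia.
    by move=> i lt_in x; rewrite !H //; lia.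
  - apply: (@sum_form_assoc _ _ _ c 1); rewrite ?expr1n ?mulr1 // => x.
    by rewrite pE; congr (_ + _); apply: eq_bigr => i _; rewrite expr1n mul1r.
  - apply: (@sum_form_assoc _ _ _ 0 w); rewrite ?mul0r // => x.
    by rewrite pE add0r.
  - exact: product_form_assoc pE.
move=> p_assoc; pose F := seq_fun p.
have F_ext := @seq_fun_ext _ _ p; have pF := @seq_fun_nth _ _ p.
have F_poly := polynomial_seq_fun p_poly.
have F_assoc k s t := @associative_seq_fun _ _ _ k s t p_assoc.
case: (boolp.pselect (exists s t, F s <> F t)) => [F_ncst|F_cst]; last first.
  left; exists (F (fun=> 0)) => x; rewrite -pF.
  by apply/eqP/negPn/negP => /eqP H; apply: F_cst; exists (nth 0 x), (fun=> 0).
right; case: (boolp.pselect (indep F n.-1)) => [F_last|F_last].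
  by left=> x; rewrite -pF (indep_last_proj R_inf n_ge2 F_ext F_poly F_assoc).
right; case: (boolp.pselect (indep F 0)) => [F_first|F_first].
  by left=> x; rewrite -pF (indep_first_proj R_inf n_ge2 F_ext F_poly F_assoc).
right.
have F_aff k s v (lt_kn : (k < n)%N) :=
  slice_affine R_inf n_ge2 F_ext F_poly F_assoc s F_first F_last lt_kn v.
have [dF1|[dep1 depn]] :=
    dF_first_eq1_or_dep n_ge2 F_ext F_assoc F_aff F_first.
  have [c [w [w1 cw FE]]] := sum_form n_ge2 F_ext F_assoc F_aff dF1 F_last.
  have [w_eq1|w_neq1] := eqVneq w 1.
    left; exists c => x; rewrite -pF FE; congr (_ + _); apply: eq_bigr => i _.
    by rewrite w_eq1 expr1n mul1r.
  have c0 : c = 0.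
    apply/eqP; move/eqP: cw; rewrite -subr_eq0 -{2}[c]mulr1 -mulrBr mulf_eq0.
    by rewrite subr_eq0 (negPf w_neq1) orbF.
  right; left; split.
    (* For [n = 2] the condition on [w] reads [w = 1]. *)
    rewrite ltn_neqAle n_ge2 andbT; apply: contra w_neq1 => /eqP n2.
    by rewrite -w1 -n2 expr1.
  by exists w; split=> // x; rewrite -pF FE c0 add0r.
right; right.
have [a [b [a_neq0 FE]]] := factor_form n_ge2 F_ext F_assoc F_aff dep1 depn.
have [c [d [c_neq0 d1 d2 prodE]]] := product_form n_ge2 F_ext F_ncst a_neq0 FE.
by exists c, d; split=> // x; rewrite -pF prodE.
Qed.
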